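(* Let $H$ be a bialgebra, $A$ an algebra in the monoidal category ${\cal LR}(H)$ of Yetter–Drinfeld–Long bimodules, and ${\cal A}$ an $H$-bimodule algebra. Then: (i) ${\cal A}\,\natural\, A$ is an $H$-bimodule algebra, with $H$-module structures given by $h\cdot (\varphi\,\natural\, a)=h_1\cdot\varphi\,\natural\, h_2\cdot a$ and $(\varphi\,\natural\, a)\cdot h=\varphi\cdot h_2\,\natural\, a\cdot h_1$, for all $\varphi\in{\cal A}$, $a\in A$, $h\in H$. (ii) $A\,\natural\, H$ is an $H$-bicomodule algebra, with $H$-comodule structures given by \begin{align*} &\lambda:A\,\natural\, H\to H\otimes (A\,\natural\, H),\quad \lambda(a\,\natural\, h)=a^{(-1)}h_1\otimes (a^{(0)}\,\natural\, h_2),\\ &\rho:A\,\natural\, H\to (A\,\natural\, H)\otimes H,\quad \rho(a\,\natural\, h)=(a^{<0>}\,\natural\, h_1)\otimes h_2a^{<1>}. \end{align*} (iii) The algebras $({\cal A}\,\natural\, A)\,\natural\, H$ and ${\cal A}\,\natural\,(A\,\natural\, H)$ coincide (on the underlying space ${\cal A}\otimes A\otimes H$), where ${\cal A}\,\natural\, A$ carries the bimodule algebra structure of (i) and $A\,\natural\, H$ the bicomodule algebra structure of (ii).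
   Context: Everything is over a field $k$; algebras are associative and unital. $H$ is a bialgebra with comultiplication $\Delta(h)=h_1\otimes h_2$ and counit $\varepsilon$. $H$-bimodule algebra: an algebra ${\cal A}$ that is an $H$-bimodule (actions $h\cdot\varphi$, $\varphi\cdot h$) with $h\cdot(\varphi\varphi')=(h_1\cdot\varphi)(h_2\cdot\varphi')$, $h\cdot 1=\varepsilon(h)1$, $(\varphi\varphi')\cdot h=(\varphi\cdot h_1)(\varphi'\cdot h_2)$, $1\cdot h=\varepsilon(h)1$. $H$-bicomodule algebra: an algebra $\mathbb{A}$ that is an $H$-bicomodule with left coaction $u\mapsto u_{[-1]}\otimes u_{[0]}\in H\otimes\mathbb{A}$ and right coaction $u\mapsto u_{<0>}\otimes u_{<1>}\in\mathbb{A}\otimes H$, both being algebra maps. L-R-smash product: for ${\cal A}$ an $H$-bimodule algebra and $\mathbb{A}$ an $H$-bicomodule algebra, ${\cal A}\,\natural\,\mathbb{A}$ is ${\cal A}\otimes\mathbb{A}$ with the associative multiplication $(\varphi\,\natural\, u)(\varphi'\,\natural\, u')=(\varphi\cdot u'_{<1>})(u_{[-1]}\cdot\varphi')\,\natural\, u_{[0]}u'_{<0>}$ and unit $1\otimes 1$. For $\mathbb{A}=H$ (both coactions equal to $\Delta$) this reads $(\varphi\,\natural\, h)(\varphi'\,\natural\, h')=(\varphi\cdot h'_2)(h_1\cdot\varphi')\,\natural\, h_2h'_1$. The category ${\cal LR}(H)$: objects are vector spaces $M$ endowed with $H$-bimodule and $H$-bicomodule structures, denoted $h\otimes m\mapsto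 h\cdot m$, $m\otimes h\mapsto m\cdot h$, $m\mapsto m^{(-1)}\otimes m^{(0)}\in H\otimes M$, $m\mapsto m^{<0>}\otimes m^{<1>}\in M\otimes H$, such that for all $h\in H$, $m\in M$: \begin{align*} &(h_1\cdot m)^{(-1)}h_2\otimes (h_1\cdot m)^{(0)}=h_1m^{(-1)}\otimes h_2\cdot m^{(0)},\\ &(h\cdot m)^{<0>}\otimes (h\cdot m)^{<1>}=h\cdot m^{<0>}\otimes m^{<1>},\\ &(m\cdot h_2)^{<0>}\otimes h_1(m\cdot h_2)^{<1>}=m^{<0>}\cdot h_1\otimes m^{<1>}h_2,\\ &(m\cdot h)^{(-1)}\otimes (m\cdot h)^{(0)}=m^{(-1)}\otimes m^{(0)}\cdot h. \end{align*} Morphisms are the $H$-bilinear $H$-bicolinear maps. ${\cal LR}(H)$ is strict monoidal with unit $k$ (trivial structures) and tensor product $M\otimes N$ with structures \begin{align*} &h\cdot(m\otimes n)=h_1\cdot m\otimes h_2\cdot n,\qquad (m\otimes n)\cdot h=m\cdot h_1\otimes n\cdot h_2,\\ &(m\otimes n)^{(-1)}\otimes(m\otimes n)^{(0)}=m^{(-1)}n^{(-1)}\otimes(m^{(0)}\otimes n^{(0)}),\\ &(m\otimes n)^{<0>}\otimes(m\otimes n)^{<1>}=(m^{<0>}\otimes n^{<0>})\otimes m^{<1>}n^{<1>}. \end{align*} An algebra in ${\cal LR}(H)$ is an object $A$ with an associative unital algebra structure whose multiplication $A\otimes A\to A$ and unit $k\to A$ are morphisms in ${\cal LR}(H)$.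 In particular such an $A$ is an $H$-bimodule algebra and an $H$-bicomodule algebra (with left coaction $a^{(-1)}\otimes a^{(0)}$ and right coaction $a^{<0>}\otimes a^{<1>}$), so ${\cal A}\,\natural\, A$ and $A\,\natural\, H$ are defined. *)

(* Defs.v *)
From HB Require Import structures.
From mathcomp Require Import all_boot all_algebra.
From mathcomp Require Import boolp.

Set Implicit Arguments.
Unset Strict Implicit.
Unset Printing Implicit Defensive.

Import GRing.Theory.
Local Open Scope ring_scope.
Local Open Scope quotient_scope.

Definition bilinear_map (k : fieldType) (V W U : lmodType k)
    (f : V -> W -> U) : Prop :=
  (forall w, linear (f^~ w)) /\ (forall v, linear (f v)).

(* [tens V W] is the free commutative monoid of formal sums of pairs
   [(v, w)], encoded as sequences, modulo the congruence generated by the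
   bilinearity relations. *)

Section TensorProduct.
Variables (k : fieldType) (V W : lmodType k).
Implicit Types (s t : seq (V * W)) (v : V) (w : W) (a : k).

Inductive tens_rel : seq (V * W) -> seq (V * W) -> Prop :=
| tens_rel_refl s : tens_rel s s
| tens_rel_sym s t : tens_rel s t -> tens_rel t s
| tens_rel_trans s t u : tens_rel s t -> tens_rel t u -> tens_rel s u
| tens_rel_cat s s' t t' :
    tens_rel s s' -> tens_rel t t' -> tens_rel (s ++ t) (s' ++ t')
| tens_rel_catC s t : tens_rel (s ++ t) (t ++ s)
| tens_rel_0l w : tens_rel [:: (0, w)] [::]
| tens_rel_Dl v v' w : tens_rel [:: (v + v', w)] [:: (v, w); (v', w)]
| tens_rel_Dr v w w' : tens_rel [:: (v, w + w')] [:: (v, w); (v, w')]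
| tens_rel_Z a v w : tens_rel [:: (a *: v, w)] [:: (v, a *: w)].

Definition tens_relb : rel (seq (V * W)) := fun s t => `[< tens_rel s t >].

Lemma tens_relb_refl : reflexive tens_relb.
Proof. by move=> s; apply/asboolP/tens_rel_refl. Qed.

Lemma tens_relb_sym : symmetric tens_relb.
Proof. by move=> s t; apply/asboolP/asboolP; apply: tens_rel_sym. Qed.

Lemma tens_relb_trans : transitive tens_relb.
Proof.
by move=> t s u /asboolP st /asboolP tu; apply/asboolP/(tens_rel_trans st tu).
Qed.

Canonical tens_equiv :=
  EquivRel tens_relb tens_relb_refl tens_relb_sym tens_relb_trans.

Definition tens_type := {eq_quot tens_equiv}.

HB.instance Definition _ := Choice.on tens_type.

Definition tens_pi s : tens_type := \pi_tens_type s.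

Lemma tens_piP s t : tens_rel s t <-> tens_pi s = tens_pi t.
Proof.
split=> [st|/eqP]; first by apply/eqmodP/asboolP.
by move/eqP/eqmodP/asboolP.
Qed.

Lemma tens_pi_repr (x : tens_type) : tens_pi (repr x) = x.
Proof. exact: reprK. Qed.

Lemma tens_repr_pi s : tens_rel (repr (tens_pi s)) s.
Proof. by apply/tens_piP; rewrite tens_pi_repr. Qed.

Definition tscale_seq a s := [seq (a *: p.1, p.2) | p <- s].

Lemma tscale_rel a s t :
  tens_rel s t -> tens_rel (tscale_seq a s) (tscale_seq a t).
Proof.
elim=> {s t} [s|s t _|s t u _ st _|s s' t t' _ ss' _|s t|w|v v' w|v w w'|b v w].
- exact: tens_rel_refl.
- exact: tens_rel_sym.
- exact: tens_rel_trans.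
- by rewrite /tscale_seq !map_cat; apply: tens_rel_cat.
- by rewrite /tscale_seq !map_cat; apply: tens_rel_catC.
- by rewrite /= scaler0; apply: tens_rel_0l.
- by rewrite /= scalerDr; apply: tens_rel_Dl.
- exact: tens_rel_Dr.
- by rewrite /= scalerA mulrC -scalerA; apply: tens_rel_Z.
Qed.

Lemma tscale_seq_cat a s t : tscale_seq a (s ++ t) = tscale_seq a s ++ tscale_seq a t.
Proof. exact: map_cat. Qed.

Definition tzero : tens_type := tens_pi [::].
Definition tadd (x y : tens_type) : tens_type := tens_pi (repr x ++ repr y).
Definition tscale a (x : tens_type) : tens_type :=
  tens_pi (tscale_seq a (repr x)).

Lemma tadd_pi s t : tadd (tens_pi s) (tens_pi t) = tens_pi (s ++ t).
Proof. by apply/tens_piP; apply: tens_rel_cat; apply: tens_repr_pi. Qed.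

Lemma tscale_pi a s : tscale a (tens_pi s) = tens_pi (tscale_seq a s).
Proof. by apply/tens_piP/tscale_rel/tens_repr_pi. Qed.

Lemma taddA : associative tadd.
Proof.
move=> x y z; rewrite -(tens_pi_repr x) -(tens_pi_repr y) -(tens_pi_repr z).
by rewrite !tadd_pi catA.
Qed.

Lemma taddC : commutative tadd.
Proof.
move=> x y; rewrite -(tens_pi_repr x) -(tens_pi_repr y) !tadd_pi.
exact/tens_piP/tens_rel_catC.
Qed.

Lemma tadd0 : left_id tzero tadd.
Proof. by move=> x; rewrite -(tens_pi_repr x) tadd_pi. Qed.

Lemma tens_rel_cons p s t : tens_rel s t -> tens_rel (p :: s) (p :: t).
Proof. by apply: (@tens_rel_cat [:: p] [:: p]); apply: tens_rel_refl. Qed.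

Lemma tscaleDl (x : tens_type) :
  {morph tscale^~ x : a b / a + b >-> tadd a b}.
Proof.
move=> a b; rewrite -(tens_pi_repr x) !tscale_pi tadd_pi; apply/tens_piP.
elim: (repr x) => [|[v w] s IHs] /=; first exact: tens_rel_refl.
rewrite scalerDl.
have r1 := tens_rel_cat (tens_rel_Dl (a *: v) (b *: v) w) IHs.
apply: (tens_rel_trans r1); apply: tens_rel_cons; rewrite -cat_rcons -cats1.
rewrite -[X in tens_rel X _]/([:: (b *: v, w)] ++ _) catA.
exact: tens_rel_cat (tens_rel_catC _ _) (tens_rel_refl _).
Qed.

Lemma tscale0 (x : tens_type) : tscale 0 x = tzero.
Proof.
rewrite -(tens_pi_repr x) tscale_pi; apply/tens_piP.
elim: (repr x) => [|[v w] s IHs] /=; first exact: tens_rel_refl.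
by rewrite scale0r; apply: (tens_rel_cat (tens_rel_0l w) IHs).
Qed.

Lemma tscale1 : left_id 1 tscale.
Proof.
move=> x; rewrite -(tens_pi_repr x) tscale_pi /tscale_seq; congr tens_pi.
by rewrite -[RHS]map_id; apply: eq_map => -[v w] /=; rewrite scale1r.
Qed.

Lemma tscaleA a b (x : tens_type) : tscale a (tscale b x) = tscale (a * b) x.
Proof.
rewrite -(tens_pi_repr x) !tscale_pi /tscale_seq -map_comp; congr tens_pi.
by apply: eq_map => -[v w] /=; rewrite scalerA.
Qed.

Lemma tscaleDr : right_distributive tscale tadd.
Proof.
move=> a x y; rewrite -(tens_pi_repr x) -(tens_pi_repr y).
by rewrite tadd_pi !tscale_pi tadd_pi tscale_seq_cat.
Qed.

Lemma taddN : left_inverse tzero (tscale (-1)) tadd.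
Proof. by move=> x; rewrite -{2}[x]tscale1 -tscaleDl addNr tscale0. Qed.

HB.instance Definition _ :=
  GRing.isZmodule.Build tens_type taddA taddC tadd0 taddN.
HB.instance Definition _ :=
  GRing.Zmodule_isLmodule.Build k tens_type tscaleA tscale1 tscaleDr tscaleDl.

Definition tens : lmodType k := tens_type.

Definition tpure v w : tens := tens_pi [:: (v, w)].

(* Sweedler sums: if [x] is the sum of the [x_1 \otimes x_2], then [tsum x f]
   is the sum of the [f x_1 x_2]. The decomposition used is an arbitrary one;
   the result does not depend on it when [f] is bilinear ([tsum_pi],
   [tsum_tpure]). *)
Definition tsum (U : lmodType k) (x : tens) (f : V -> W -> U) : U :=
  \sum_(p <- repr (x : tens_type)) f p.1 p.2.

End TensorProduct.

Notation "V ⊗ W" := (tens V W) (at level 40, left associativity) : type_scope.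
Notation "v ⊗ w" := (tpure v w) (at level 40, left associativity) : ring_scope.
Notation "\tsum_ ( x , y <- t ) F" := (tsum t (fun x y => F))
  (at level 41, F at level 41, x binder, y binder, t at level 50,
   format "'[' \tsum_ ( x ,  y  <-  t ) '/  '  F ']'") : ring_scope.

Section TensorTheory.
Variables (k : fieldType) (V W : lmodType k).

Lemma tpure_bilinear : bilinear_map (@tpure k V W).
Proof.
have pureDl v v' (w : W) : (v + v') ⊗ w = v ⊗ w + v' ⊗ w :> (V ⊗ W)%type.
  by rewrite /tpure [RHS]tadd_pi; apply/tens_piP/tens_rel_Dl.
have pureDr (v : V) w w' : v ⊗ (w + w') = v ⊗ w + v ⊗ w' :> (V ⊗ W)%type.
  by rewrite /tpure [RHS]tadd_pi; apply/tens_piP/tens_rel_Dr.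
have pureZl a v (w : W) : (a *: v) ⊗ w = a *: (v ⊗ w) :> (V ⊗ W)%type.
  by rewrite /tpure [RHS]tscale_pi.
have pureZr a (v : V) w : v ⊗ (a *: w) = a *: (v ⊗ w) :> (V ⊗ W)%type.
  by rewrite -pureZl; apply/tens_piP/tens_rel_sym/tens_rel_Z.
by split=> [w a v v'|v a w w']; rewrite ?pureDl ?pureZl ?pureDr ?pureZr.
Qed.

Variable U : lmodType k.
Implicit Type f : V -> W -> U.

Lemma tsum_pi f s : bilinear_map f ->
  \tsum_(v, w <- tens_pi s) f v w = \sum_(p <- s) f p.1 p.2.
Proof.
move=> [fl fr]; rewrite /tsum.
move: (repr _) (tens_repr_pi s) => t ts; elim: ts => {s t} //=.
- by move=> s t u _ -> _ ->.
- by move=> s s' t t' _ IHs _ IHt; rewrite !big_cat /= IHs IHt.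
- by move=> s t; rewrite !big_cat /= addrC.
- move=> w; rewrite big_seq1 big_nil /=.
  by have /= := fl w (-1) 0 0; rewrite scaler0 addr0 scaleN1r addNr.
- move=> v v' w; rewrite !big_cons !big_nil !addr0 /=.
  by have /= := fl w 1 v v'; rewrite !scale1r.
- move=> v w w'; rewrite !big_cons !big_nil !addr0 /=.
  by have := fr v 1 w w'; rewrite !scale1r.
- move=> a v w; rewrite !big_seq1 /=.
  have f0l : f 0 w = 0.
    by have /= := fl w (-1) 0 0; rewrite scaler0 addr0 scaleN1r addNr.
  have f0r : f v 0 = 0.
    by have := fr v (-1) 0 0; rewrite scaler0 addr0 scaleN1r addNr.
  have /= := fl w a v 0; rewrite !addr0 f0l addr0 => ->.
  by have := fr v a w 0; rewrite !addr0 f0r addr0 => ->.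
Qed.

Lemma tsum_tpure f v w : bilinear_map f ->
  \tsum_(x, y <- v ⊗ w) f x y = f v w.
Proof. by move=> fB; rewrite tsum_pi // big_seq1. Qed.

Lemma tsum_linear f : bilinear_map f -> linear (fun t => tsum t f).
Proof.
move=> fB a x y; rewrite -(tens_pi_repr x) -(tens_pi_repr y).
have -> : a *: (tens_pi (repr x) : (V ⊗ W)%type) + tens_pi (repr y) =
          tens_pi (tscale_seq a (repr x) ++ repr y).
  by rewrite -tadd_pi -tscale_pi.
rewrite !tsum_pi // big_cat /= big_map scaler_sumr; congr (_ + _).
apply: eq_bigr => p _; have /= := fB.1 p.2 a p.1 0.
have /= := fB.1 p.2 (-1) 0 0; rewrite scaler0 addr0 scaleN1r addNr => ->.
by rewrite !addr0.
Qed.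

End TensorTheory.

Lemma tsum_id (k : fieldType) (V W : lmodType k) (t : (V ⊗ W)%type) :
  \tsum_(v, w <- t) v ⊗ w = t.
Proof.
rewrite -[RHS](tens_pi_repr t) /tsum; elim: (repr _) => [|[v w] s IHs].
  by rewrite big_nil.
by rewrite big_cons {}IHs [LHS]tadd_pi.
Qed.

Definition tassoc (k : fieldType) (V W U : lmodType k)
    (t : ((V ⊗ W) ⊗ U)%type) : (V ⊗ (W ⊗ U))%type :=
  \tsum_(x, u <- t) \tsum_(v, w <- x) v ⊗ (w ⊗ u).

HB.mixin Record isBialgebra (k : fieldType) H of GRing.Algebra k H := {
  comul : {linear H -> (H ⊗ H)%type};
  counit : {scalar H};
  comulA : forall h : H,
    \tsum_(h1, h2 <- comul h) \tsum_(x, y <- comul h1) x ⊗ (y ⊗ h2) =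
    \tsum_(h1, h2 <- comul h) \tsum_(x, y <- comul h2) h1 ⊗ (x ⊗ y);
  comul_counitl : forall h : H, \tsum_(h1, h2 <- comul h) counit h1 *: h2 = h;
  comul_counitr : forall h : H, \tsum_(h1, h2 <- comul h) counit h2 *: h1 = h;
  comul1 : comul 1 = 1 ⊗ 1;
  comulM : forall h g : H, comul (h * g) =
    \tsum_(h1, h2 <- comul h) \tsum_(g1, g2 <- comul g) (h1 * g1) ⊗ (h2 * g2);
  counit1 : counit 1 = 1;
  counitM : forall h g : H, counit (h * g) = counit h * counit g
}.

#[short(type="bialgType")]
HB.structure Definition Bialgebra (k : fieldType) :=
  {H of isBialgebra k H & GRing.Algebra k H}.

(* The operations are kept apart from their axioms, because one space may
   carry several structures (A \otimes A has both a tensor product algebra and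
   smash product algebra structures). Moreover [algType] excludes the zero
   algebra, which is allowed here. *)

Record alg_ops (k : fieldType) (A : lmodType k) :=
  AlgOps { amul : A -> A -> A; aone : A }.

Record bimod_ops (k : fieldType) (H M : lmodType k) :=
  BimodOps { lact : H -> M -> M; ract : M -> H -> M }.

Record bicomod_ops (k : fieldType) (H M : lmodType k) :=
  BicomodOps { lcoact : M -> (H ⊗ M)%type; rcoact : M -> (M ⊗ H)%type }.

Definition ring_alg_ops (k : fieldType) (H : algType k) : alg_ops H :=
  AlgOps ( *%R : H -> H -> H) 1.

Definition tens_alg_ops (k : fieldType) (A B : lmodType k)
    (mA : alg_ops A) (mB : alg_ops B) : alg_ops (A ⊗ B)%type :=
  AlgOps
    (fun t u => \tsum_(a, b <- t) \tsum_(a', b' <- u)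
       (amul mA a a') ⊗ (amul mB b b'))
    (aone mA ⊗ aone mB).

Record is_algebra (k : fieldType) (A : lmodType k) (m : alg_ops A) : Prop := {
  amul_bilinear : bilinear_map (amul m);
  amulA : associative (amul m);
  amul1l : left_id (aone m) (amul m);
  amul1r : right_id (aone m) (amul m)
}.

Record is_algebra_map (k : fieldType) (A B : lmodType k)
    (mA : alg_ops A) (mB : alg_ops B) (f : A -> B) : Prop := {
  algebra_map_linear : linear f;
  algebra_map1 : f (aone mA) = aone mB;
  algebra_mapM : forall x y, f (amul mA x y) = amul mB (f x) (f y)
}.

Section Structures.
Variables (k : fieldType) (H : bialgType k).

Definition regular_bicomod_ops : bicomod_ops H H :=
  BicomodOps (comul : H -> (H ⊗ H)%type) (comul : H -> (H ⊗ H)%type).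

Section Single.
Variable M : lmodType k.
Implicit Types (m : alg_ops M) (b : bimod_ops H M) (c : bicomod_ops H M).

Record is_bimodule b : Prop := {
  lact_bilinear : bilinear_map (lact b);
  ract_bilinear : bilinear_map (ract b);
  lact1 : forall x, lact b 1 x = x;
  lactM : forall h g x, lact b (h * g) x = lact b h (lact b g x);
  ract1 : forall x, ract b x 1 = x;
  ractM : forall x h g, ract b x (h * g) = ract b (ract b x h) g;
  lract : forall h x g, ract b (lact b h x) g = lact b h (ract b x g)
}.

Record is_bicomodule c : Prop := {
  lcoact_linear : linear (lcoact c);
  rcoact_linear : linear (rcoact c);
  lcoact_counit : forall x, \tsum_(h, x0 <- lcoact c x) counit h *: x0 = x;
  lcoactA : forall x,
    \tsum_(h, x0 <- lcoact c x) \tsum_(h1, h2 <- comul h) h1 ⊗ (h2 ⊗ x0) =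
    \tsum_(h, x0 <- lcoact c x) \tsum_(g, x1 <- lcoact c x0) h ⊗ (g ⊗ x1);
  rcoact_counit : forall x, \tsum_(x0, h <- rcoact c x) counit h *: x0 = x;
  rcoactA : forall x,
    \tsum_(x0, h <- rcoact c x) \tsum_(x1, g <- rcoact c x0) x1 ⊗ (g ⊗ h) =
    \tsum_(x0, h <- rcoact c x) \tsum_(h1, h2 <- comul h) x0 ⊗ (h1 ⊗ h2);
  lrcoact : forall x,
    \tsum_(x0, g <- rcoact c x) \tsum_(h, x1 <- lcoact c x0) h ⊗ (x1 ⊗ g) =
    \tsum_(h, x0 <- lcoact c x) \tsum_(x1, g <- rcoact c x0) h ⊗ (x1 ⊗ g)
}.

Record is_bimodule_algebra m b : Prop := {
  bimodule_algebra_algebra : is_algebra m;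
  bimodule_algebra_bimodule : is_bimodule b;
  lact_amul : forall h x y, lact b h (amul m x y) =
    \tsum_(h1, h2 <- comul h) amul m (lact b h1 x) (lact b h2 y);
  lact_aone : forall h, lact b h (aone m) = counit h *: aone m;
  ract_amul : forall x y h, ract b (amul m x y) h =
    \tsum_(h1, h2 <- comul h) amul m (ract b x h1) (ract b y h2);
  ract_aone : forall h, ract b (aone m) h = counit h *: aone m
}.

Record is_bicomodule_algebra m c : Prop := {
  bicomodule_algebra_algebra : is_algebra m;
  bicomodule_algebra_bicomodule : is_bicomodule c;
  lcoact_algebra_map :
    is_algebra_map m (tens_alg_ops (ring_alg_ops H) m) (lcoact c);
  rcoact_algebra_map :
    is_algebra_map m (tens_alg_ops m (ring_alg_ops H)) (rcoact c)
}.

Record is_LR_object b c : Prop := {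
  LR_bimodule : is_bimodule b;
  LR_bicomodule : is_bicomodule c;
  LR_lact_lcoact : forall h x,
    \tsum_(h1, h2 <- comul h) \tsum_(g, x0 <- lcoact c (lact b h1 x))
      (g * h2) ⊗ x0 =
    \tsum_(h1, h2 <- comul h) \tsum_(g, x0 <- lcoact c x)
      (h1 * g) ⊗ (lact b h2 x0);
  LR_lact_rcoact : forall h x,
    rcoact c (lact b h x) = \tsum_(x0, g <- rcoact c x) (lact b h x0) ⊗ g;
  LR_ract_rcoact : forall h x,
    \tsum_(h1, h2 <- comul h) \tsum_(x0, g <- rcoact c (ract b x h2))
      x0 ⊗ (h1 * g) =
    \tsum_(h1, h2 <- comul h) \tsum_(x0, g <- rcoact c x)
      (ract b x0 h1) ⊗ (g * h2);
  LR_ract_lcoact : forall h x,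
    lcoact c (ract b x h) = \tsum_(g, x0 <- lcoact c x) g ⊗ (ract b x0 h)
}.

End Single.

Record is_LR_morphism (M N : lmodType k)
    (bM : bimod_ops H M) (cM : bicomod_ops H M)
    (bN : bimod_ops H N) (cN : bicomod_ops H N) (f : M -> N) : Prop := {
  LR_morphism_linear : linear f;
  LR_morphism_lact : forall h x, f (lact bM h x) = lact bN h (f x);
  LR_morphism_ract : forall x h, f (ract bM x h) = ract bN (f x) h;
  LR_morphism_lcoact : forall x,
    lcoact cN (f x) = \tsum_(h, x0 <- lcoact cM x) h ⊗ (f x0);
  LR_morphism_rcoact : forall x,
    rcoact cN (f x) = \tsum_(x0, h <- rcoact cM x) (f x0) ⊗ h
}.

Definition LR_unit_bimod_ops : bimod_ops H k^o :=
  BimodOps (fun h (x : k^o) => (counit h *: x : k^o))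
           (fun (x : k^o) h => (counit h *: x : k^o)).

Definition LR_unit_bicomod_ops : bicomod_ops H k^o :=
  BicomodOps (fun x : k^o => (1 : H) ⊗ x) (fun x : k^o => x ⊗ (1 : H)).

Definition LR_tens_bimod_ops (M N : lmodType k)
    (bM : bimod_ops H M) (bN : bimod_ops H N) : bimod_ops H (M ⊗ N)%type :=
  BimodOps
    (fun h t => \tsum_(x, y <- t) \tsum_(h1, h2 <- comul h)
       (lact bM h1 x) ⊗ (lact bN h2 y))
    (fun t h => \tsum_(x, y <- t) \tsum_(h1, h2 <- comul h)
       (ract bM x h1) ⊗ (ract bN y h2)).

Definition LR_tens_bicomod_ops (M N : lmodType k)
    (cM : bicomod_ops H M) (cN : bicomod_ops H N) :
    bicomod_ops H (M ⊗ N)%type :=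
  BicomodOps
    (fun t => \tsum_(x, y <- t)
       \tsum_(g, x0 <- lcoact cM x) \tsum_(h, y0 <- lcoact cN y)
         (g * h) ⊗ (x0 ⊗ y0))
    (fun t => \tsum_(x, y <- t)
       \tsum_(x0, g <- rcoact cM x) \tsum_(y0, h <- rcoact cN y)
         (x0 ⊗ y0) ⊗ (g * h)).

Record is_LR_algebra (A : lmodType k) (m : alg_ops A)
    (b : bimod_ops H A) (c : bicomod_ops H A) : Prop := {
  LR_algebra_algebra : is_algebra m;
  LR_algebra_object : is_LR_object b c;
  LR_algebra_mul :
    is_LR_morphism (LR_tens_bimod_ops b b) (LR_tens_bicomod_ops c c) b c
      (fun t : (A ⊗ A)%type => \tsum_(x, y <- t) amul m x y);
  LR_algebra_one :
    is_LR_morphism LR_unit_bimod_ops LR_unit_bicomod_ops b c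
      (fun x : k^o => (x : k) *: aone m)
}.

(* [B] is a bimodule algebra and [A] a bicomodule algebra; on pure tensors
   (p # u) (p' # u') = (p . u'_<1>) (u_[-1] . p') # u_[0] u'_<0>. *)
Definition smash (B A : lmodType k) (mB : alg_ops B) (bB : bimod_ops H B)
    (mA : alg_ops A) (cA : bicomod_ops H A) : alg_ops (B ⊗ A)%type :=
  AlgOps
    (fun t t' => \tsum_(p, u <- t) \tsum_(p', u' <- t')
       \tsum_(h, u0 <- lcoact cA u) \tsum_(u'0, g <- rcoact cA u')
         (amul mB (ract bB p g) (lact bB h p')) ⊗ (amul mA u0 u'0))
    (aone mB ⊗ aone mA).

(* Unlike in the tensor product of LR(H), the right action is twisted:
   h . (p # a) = h_1 . p # h_2 . a and (p # a) . h = p . h_2 # a . h_1. *)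
Definition smash_bimod_ops (B A : lmodType k)
    (bB : bimod_ops H B) (bA : bimod_ops H A) : bimod_ops H (B ⊗ A)%type :=
  BimodOps
    (fun h t => \tsum_(p, a <- t) \tsum_(h1, h2 <- comul h)
       (lact bB h1 p) ⊗ (lact bA h2 a))
    (fun t h => \tsum_(p, a <- t) \tsum_(h1, h2 <- comul h)
       (ract bB p h2) ⊗ (ract bA a h1)).

(* a # h |-> a^(-1) h_1 \otimes (a^(0) # h_2) and
   a # h |-> (a^<0> # h_1) \otimes h_2 a^<1>. *)
Definition smash_bicomod_ops (A : lmodType k) (cA : bicomod_ops H A) :
    bicomod_ops H (A ⊗ H)%type :=
  BicomodOps
    (fun t => \tsum_(a, h <- t) \tsum_(g, a0 <- lcoact cA a)
       \tsum_(h1, h2 <- comul h) (g * h1) ⊗ (a0 ⊗ h2))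
    (fun t => \tsum_(a, h <- t) \tsum_(a0, g <- rcoact cA a)
       \tsum_(h1, h2 <- comul h) (a0 ⊗ h1) ⊗ (h2 * g)).

End Structures.

Arguments regular_bicomod_ops {k} H.

(* Main.v *)
(** All operations involved are multilinear, so every identity to be proved is one
between iterated Sweedler sums, and most of them follow by comparing normal forms. This
covers the associativity of smash products and everything else except four identities:
compatibility of the left (right) action on [B # A] with the product, and
multiplicativity of the left (right) coaction of [A # H]. There the condition
(h_1 . a)^(-1) h_2 ⊗ (h_1 . a)^(0) = h_1 a^(-1) ⊗ h_2 . a^(0), respectively its
mirror image for the right structures, is used exactly once, on two adjacent
Sweedler components of [h]. *)

Require Import Defs.
From mathcomp Require Import all_boot all_algebra.
From mathcomp Require Import boolp.

Set Implicit Arguments.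
Unset Strict Implicit.
Unset Printing Implicit Defensive.

Import GRing.Theory.
Local Open Scope ring_scope.

(** * Linear and bilinear maps and their interplay with Sweedler sums *)

Section TensorSums.
Variable k : fieldType.

(* These restate [linear] and [bilinear_map] with a head constant whose only
   structures are those of left modules, for syntactic matching in [lin]. *)
Definition is_linear (V U : lmodType k) (f : V -> U) : Prop :=
  forall a x y, f (a *: x + y) = a *: f x + f y.

Definition is_bilinear (V W U : lmodType k) (f : V -> W -> U) : Prop :=
  (forall w, is_linear (fun v => f v w)) /\ (forall v, is_linear (f v)).

Lemma is_linear_id (V : lmodType k) : is_linear (fun v : V => v).
Proof. by []. Qed.

Lemma is_linear_comp (V W U : lmodType k) (f : W -> U) (g : V -> W) :
  is_linear f -> is_linear g -> is_linear (fun v => f (g v)).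
Proof. by move=> fL gL a x y; rewrite gL fL. Qed.

Lemma is_linear0 (V U : lmodType k) (f : V -> U) : is_linear f -> f 0 = 0.
Proof. by move=> fL; have := fL (-1) 0 0; rewrite scaler0 addr0 scaleN1r addNr. Qed.

Lemma is_linearD (V U : lmodType k) (f : V -> U) : is_linear f ->
  {morph f : x y / x + y}.
Proof. by move=> fL x y; have := fL 1 x y; rewrite !scale1r. Qed.

Lemma is_linearZ (V U : lmodType k) (f : V -> U) : is_linear f ->
  forall a x, f (a *: x) = a *: f x.
Proof. by move=> fL a x; have := fL a x 0; rewrite !addr0 is_linear0 // addr0. Qed.

Lemma bilinearZl (V W U : lmodType k) (f : V -> W -> U) : is_bilinear f ->
  forall a x y, f (a *: x) y = a *: f x y.
Proof. by move=> fB a x y; apply: (is_linearZ (fB.1 y)). Qed.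

Lemma bilinearZr (V W U : lmodType k) (f : V -> W -> U) : is_bilinear f ->
  forall a x y, f x (a *: y) = a *: f x y.
Proof. by move=> fB a x y; apply: (is_linearZ (fB.2 x)). Qed.

Lemma bilinear_compl (V W U X : lmodType k) (f : W -> X -> U) (g : V -> W) x :
  is_bilinear f -> is_linear g -> is_linear (fun v => f (g v) x).
Proof. by move=> fB gL; apply: (is_linear_comp (fB.1 x)). Qed.

Lemma bilinear_compr (V W U X : lmodType k) (f : X -> W -> U) (g : V -> W) x :
  is_bilinear f -> is_linear g -> is_linear (fun v => f x (g v)).
Proof. by move=> fB gL; apply: (is_linear_comp (fB.2 x)). Qed.

Lemma eq_tsum (V W U : lmodType k) (t : (V ⊗ W)%type) (F G : V -> W -> U) :
  (forall v w, F v w = G v w) -> tsum t F = tsum t G.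
Proof. by move=> FG; apply: eq_bigr => p _; apply: FG. Qed.

(** This lemma and the next two are congruences in transitive form: [nf] first finds the normal
    arguments, then rewrites the operation applied to them. *)
Lemma eq_tsum_arg (V W U : lmodType k) (t s : (V ⊗ W)%type) (F : V -> W -> U) u :
  t = s -> tsum s F = u -> tsum t F = u.
Proof. by move=> ->. Qed.

Lemma eq_op1 (X Y : Type) (f : X -> Y) x x' y : x = x' -> f x' = y -> f x = y.
Proof. by move=> ->. Qed.

Lemma eq_op2 (X Y Z : Type) (f : X -> Y -> Z) x x' y y' z :
  x = x' -> y = y' -> f x' y' = z -> f x y = z.
Proof. by move=> -> ->. Qed.

Lemma tsumM (V W U X : lmodType k) (t : (V ⊗ W)%type) (F : V -> W -> U) (g : U -> X) :
  is_linear g -> g (tsum t F) = tsum t (fun v w => g (F v w)).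
Proof.
by move=> gL; apply: (big_morph g (is_linearD gL) (is_linear0 gL)).
Qed.

Lemma tsumMl (V W U X Y : lmodType k) (t : (V ⊗ W)%type) (F : V -> W -> U)
    (g : U -> X -> Y) x :
  is_bilinear g -> g (tsum t F) x = tsum t (fun v w => g (F v w) x).
Proof. by move=> gB; apply: (@tsumM _ _ _ _ t F (g^~ x) (gB.1 x)). Qed.

Lemma tsumMr (V W U X Y : lmodType k) (t : (V ⊗ W)%type) (F : V -> W -> U)
    (g : X -> U -> Y) x :
  is_bilinear g -> g x (tsum t F) = tsum t (fun v w => g x (F v w)).
Proof. by move=> gB; apply: (@tsumM _ _ _ _ t F (g x) (gB.2 x)). Qed.

Lemma tsum_bilinear_linear (V W U : lmodType k) (F : V -> W -> U) :
  is_bilinear F -> is_linear (fun t => tsum t F).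
Proof. exact: tsum_linear. Qed.

Lemma linear_tsuml (V W U X : lmodType k) (F : V -> W -> U) (g : X -> (V ⊗ W)%type) :
  is_bilinear F -> is_linear g -> is_linear (fun x => tsum (g x) F).
Proof. by move=> FB gL; apply: (is_linear_comp (tsum_bilinear_linear FB) gL). Qed.

(** The representative of [t] is fixed, so linearity passes through the sum term by term. *)
Lemma linear_tsumr (V W U X : lmodType k) (t : (V ⊗ W)%type) (F : X -> V -> W -> U) :
  (forall v w, is_linear (fun x => F x v w)) -> is_linear (fun x => tsum t (F x)).
Proof.
move=> FL a x y; rewrite /tsum scaler_sumr -big_split.
by apply: eq_bigr => p _; rewrite FL.
Qed.

Lemma tsum_tsum (V W U X Y : lmodType k) (t : (V ⊗ W)%type)
    (F : V -> W -> (U ⊗ X)%type) (G : U -> X -> Y) :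
  is_bilinear G -> tsum (tsum t F) G = tsum t (fun v w => tsum (F v w) G).
Proof.
move=> GB.
exact: (@tsumM _ _ _ _ t F (fun r => tsum r G) (tsum_bilinear_linear GB)).
Qed.

Lemma tsum_pure (V W U : lmodType k) (F : V -> W -> U) v w :
  is_bilinear F -> tsum (v ⊗ w) F = F v w.
Proof. exact: tsum_tpure. Qed.

(** Exchange of two finite sums: once the sum over [t] is outermost in [G], it moves past the sum
    over [s]. *)
Lemma tsum_pull (V W V' W' U : lmodType k) (s : (V ⊗ W)%type) (t : (V' ⊗ W')%type)
    (F : V -> W -> V' -> W' -> U) (G : V -> W -> U) :
  (forall v w, G v w = tsum t (F v w)) ->
  tsum s G = tsum t (fun v' w' => tsum s (fun v w => F v w v' w')).
Proof.
move=> GF; rewrite (eq_tsum _ GF) /tsum exchange_big /=.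
by apply: eq_bigr.
Qed.

Lemma bilinear_tpure (V W : lmodType k) : is_bilinear (@tpure k V W).
Proof. exact: tpure_bilinear. Qed.

Lemma bilinear_mul (H : algType k) : is_bilinear ( *%R : H -> H -> H).
Proof.
split=> [w|v] a x y; first by rewrite mulrDl scalerAl.
by rewrite mulrDr scalerAr.
Qed.

Lemma linear_comul (H : bialgType k) : is_linear (comul : H -> (H ⊗ H)%type).
Proof. by move=> a x y; rewrite linearP. Qed.

Lemma bilinear_counit (H : bialgType k) (V : lmodType k) :
  is_bilinear (fun (h : H) (v : V) => counit h *: v).
Proof.
split=> [w|v] a x y; first by rewrite linearP /= scalerDl scalerA.
by rewrite scalerDr !scalerA mulrC.
Qed.

Lemma bilinear_amul (A : lmodType k) (m : alg_ops A) : is_algebra m ->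
  is_bilinear (amul m).
Proof. exact: amul_bilinear. Qed.

Section Structures.
Variables (H : bialgType k) (M : lmodType k).
Variables (b : bimod_ops H M) (c : bicomod_ops H M).

Lemma bilinear_lact : is_bimodule b -> is_bilinear (lact b).
Proof. exact: lact_bilinear. Qed.

Lemma bilinear_ract : is_bimodule b -> is_bilinear (ract b).
Proof. exact: ract_bilinear. Qed.

Lemma linear_lcoact : is_bicomodule c -> is_linear (lcoact c).
Proof. exact: lcoact_linear. Qed.

Lemma linear_rcoact : is_bicomodule c -> is_linear (rcoact c).
Proof. exact: rcoact_linear. Qed.

End Structures.

End TensorSums.

(** * Automated linearity checks *)

Ltac bil :=
  first [ apply: bilinear_tpure | apply: bilinear_mul | apply: bilinear_counit
        | apply: bilinear_amul; eassumption
        | apply: bilinear_lact; eassumption | apply: bilinear_ract; eassumption ].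

Ltac lin1 :=
  first [ apply: linear_comul | apply: linear_lcoact; eassumption
        | apply: linear_rcoact; eassumption ].

Ltac lin_comp lin :=
  lazymatch goal with
  | |- is_linear (fun z => ?f (@?g z)) =>
      apply: (@is_linear_comp _ _ _ _ f g); [lin1|lin]
  end.

(** By multilinearity the variable occurs in one argument only, so at each node one abstracted
    argument is constant and the recursion enters the other. *)
Ltac lin :=
  cbv beta;
  lazymatch goal with
  | |- is_bilinear _ => split=> ?; cbv beta; lin
  | |- is_linear (fun z => z) => apply: is_linear_id
  | |- is_linear (fun z => tsum (@?g z) (@?F z)) =>
      lazymatch F with
      | (fun _ => ?F') => apply: (@linear_tsuml _ _ _ _ _ F' g); lin
      | _ => lazymatch g with
        (fun _ => ?t) => apply: (@linear_tsumr _ _ _ _ _ t F) => ? ?; lin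
        end
      end
  | |- is_linear (fun z => GRing.scale (GRing.Linear.sort _ (@?f z)) (@?g z)) =>
      lazymatch f with
      | (fun _ => ?x) =>
        apply: (@bilinear_compr _ _ _ _ _ (fun h v => counit h *: v) g x); [bil|lin]
      | _ => lazymatch g with
        (fun _ => ?y) =>
        apply: (@bilinear_compl _ _ _ _ _ (fun h v => counit h *: v) f y); [bil|lin]
        end
      end
  | |- is_linear (fun z => GRing.Linear.sort _ _ ) => lin_comp lin
  | |- is_linear (fun z => lcoact _ _) => lin_comp lin
  | |- is_linear (fun z => rcoact _ _) => lin_comp lin
  | |- is_linear (fun z => ?op (@?f z) (@?g z)) =>
      lazymatch f with
      | (fun _ => ?x) => apply: (@bilinear_compr _ _ _ _ _ op g x); [bil|lin]
      | _ => lazymatch g with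
        (fun _ => ?y) => apply: (@bilinear_compl _ _ _ _ _ op f y); [bil|lin]
        end
      end
  | |- is_linear ?f =>
      first [ lin1 | lazymatch f with ?op ?x =>
        apply: (@bilinear_compr _ _ _ _ _ op (fun z => z) x); [bil|lin] end ]
  end.

(** * Bialgebra and bicomodule axioms inside multilinear expressions *)

Section Multilinear.
Variable k : fieldType.

Definition is_trilinear (V W X U : lmodType k) (F : V -> W -> X -> U) : Prop :=
  [/\ forall y z, is_linear (fun x => F x y z),
      forall x z, is_linear (fun y => F x y z)
    & forall x y, is_linear (F x y)].

Lemma trilinear_tsum (V W X U : lmodType k) (F : V -> W -> X -> U) :
  is_trilinear F -> is_bilinear (fun x s => tsum s (F x)).
Proof.
move=> [F1 F2 F3]; split=> [s|x].
  by apply: (@linear_tsumr _ _ _ _ _ s (fun x v w => F x v w)) => v w.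
by apply: tsum_bilinear_linear; split.
Qed.

Lemma tsum_pure3 (V W X U : lmodType k) (F : V -> W -> X -> U) x y z :
  is_trilinear F -> tsum (x ⊗ (y ⊗ z)) (fun v s => tsum s (F v)) = F x y z.
Proof.
move=> FT; rewrite tsum_pure; last exact: trilinear_tsum.
by case: FT => F1 F2 F3; rewrite tsum_pure //; split.
Qed.

(** Evaluates the linear map induced by [F] on the triple tensor product, so that tensor identities
    such as coassociativity carry over to trilinear summands. *)
Lemma tsum_nested3 (V W X U V1 W1 V2 W2 : lmodType k) (F : V -> W -> X -> U)
    (t : (V1 ⊗ W1)%type) (s : V1 -> W1 -> (V2 ⊗ W2)%type) f g h :
  is_trilinear F ->
  tsum (\tsum_(a, b <- t) \tsum_(c, d <- s a b)
          f a b c d ⊗ (g a b c d ⊗ h a b c d)) (fun v r => tsum r (F v)) =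
  \tsum_(a, b <- t) \tsum_(c, d <- s a b) F (f a b c d) (g a b c d) (h a b c d).
Proof.
move=> FT; have FB := trilinear_tsum FT; rewrite tsum_tsum //.
apply: eq_tsum => a b; rewrite tsum_tsum //.
by apply: eq_tsum => c d; apply: tsum_pure3.
Qed.

(* [G] is kept abstract, here and below, because the inner summation is usually
   not the outermost one inside [G]: it is [pull] that brings it there. *)
Lemma tsum_trilinear (V W X U V1 W1 V2 W2 V3 W3 V4 W4 : lmodType k)
    (t : (V1 ⊗ W1)%type) (s : V1 -> W1 -> (V2 ⊗ W2)%type) f g h
    (t' : (V3 ⊗ W3)%type) (s' : V3 -> W3 -> (V4 ⊗ W4)%type) f' g' h'
    (G : V1 -> W1 -> U) (F : V -> W -> X -> U) :
  \tsum_(a, b <- t) \tsum_(c, d <- s a b)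
     f a b c d ⊗ (g a b c d ⊗ h a b c d) =
  \tsum_(a, b <- t') \tsum_(c, d <- s' a b)
     f' a b c d ⊗ (g' a b c d ⊗ h' a b c d) ->
  (forall a b, G a b =
     \tsum_(c, d <- s a b) F (f a b c d) (g a b c d) (h a b c d)) ->
  is_trilinear F ->
  tsum t G =
  \tsum_(a, b <- t') \tsum_(c, d <- s' a b)
     F (f' a b c d) (g' a b c d) (h' a b c d).
Proof.
move=> E GF FT; rewrite (eq_tsum _ GF).
by rewrite -[LHS]tsum_nested3 // E tsum_nested3.
Qed.

Section Coassociativity.
Variables (H : bialgType k) (U : lmodType k).

Lemma comulA_tsum (h : H) (G : H -> H -> U) F :
  (forall h1 h2, G h1 h2 = \tsum_(x, y <- comul h1) F x y h2) ->
  is_trilinear F ->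
  tsum (comul h) G = \tsum_(h1, h2 <- comul h) \tsum_(x, y <- comul h2) F h1 x y.
Proof. exact: tsum_trilinear (comulA h). Qed.

Variables (M : lmodType k) (c : bicomod_ops H M).
Hypothesis cM : is_bicomodule c.

Lemma lcoactA_tsum x (G : H -> M -> U) F :
  (forall h x0, G h x0 = \tsum_(h1, h2 <- comul h) F h1 h2 x0) ->
  is_trilinear F ->
  tsum (lcoact c x) G =
  \tsum_(h, x0 <- lcoact c x) \tsum_(g, x1 <- lcoact c x0) F h g x1.
Proof. exact: tsum_trilinear (lcoactA cM x). Qed.

Lemma rcoactA_tsum x (G : M -> H -> U) F :
  (forall x0 h, G x0 h = \tsum_(h1, h2 <- comul h) F x0 h1 h2) ->
  is_trilinear F ->
  tsum (rcoact c x) G =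
  \tsum_(x0, h <- rcoact c x) \tsum_(x1, g <- rcoact c x0) F x1 g h.
(* [rcoactA] is oriented oppositely to [lcoactA]. *)
Proof. exact: tsum_trilinear (esym (rcoactA cM x)). Qed.

Lemma lrcoact_tsum x (G : M -> H -> U) F :
  (forall x0 g, G x0 g = \tsum_(h, x1 <- lcoact c x0) F h x1 g) ->
  is_trilinear F ->
  tsum (rcoact c x) G =
  \tsum_(h, x0 <- lcoact c x) \tsum_(x1, g <- rcoact c x0) F h x1 g.
Proof. exact: tsum_trilinear (lrcoact cM x). Qed.

End Coassociativity.

Section Algebra.
Variables (H : bialgType k) (M : lmodType k) (m : alg_ops M).
Variables (c : bicomod_ops H M).
Hypothesis cM : is_bicomodule_algebra m c.

Lemma lcoact_amul x y : lcoact c (amul m x y) =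
  \tsum_(g, x0 <- lcoact c x) \tsum_(h, y0 <- lcoact c y) (g * h) ⊗ amul m x0 y0.
Proof. exact: (algebra_mapM (lcoact_algebra_map cM)). Qed.

Lemma rcoact_amul x y : rcoact c (amul m x y) =
  \tsum_(x0, g <- rcoact c x) \tsum_(y0, h <- rcoact c y) amul m x0 y0 ⊗ (g * h).
Proof. exact: (algebra_mapM (rcoact_algebra_map cM)). Qed.

Lemma lcoact_aone : lcoact c (aone m) = 1 ⊗ aone m.
Proof. exact: (algebra_map1 (lcoact_algebra_map cM)). Qed.

Lemma rcoact_aone : rcoact c (aone m) = aone m ⊗ 1.
Proof. exact: (algebra_map1 (rcoact_algebra_map cM)). Qed.

End Algebra.

Section Counit.
Variables (H : bialgType k) (U : lmodType k).

(** Linearity allows [F] to be applied to both sides of the counit axiom. *)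
Lemma counitl_tsum (h : H) (G : H -> H -> U) F :
  (forall h1 h2, G h1 h2 = counit h1 *: F h2) -> is_linear F ->
  tsum (comul h) G = F h.
Proof.
move=> GF FL; rewrite (eq_tsum _ GF) -[in RHS](comul_counitl h).
rewrite (tsumM _ _ FL); apply: eq_tsum => h1 h2.
by rewrite (is_linearZ FL).
Qed.

Lemma counitr_tsum (h : H) (G : H -> H -> U) F :
  (forall h1 h2, G h1 h2 = counit h2 *: F h1) -> is_linear F ->
  tsum (comul h) G = F h.
Proof.
move=> GF FL; rewrite (eq_tsum _ GF) -[in RHS](comul_counitr h).
rewrite (tsumM _ _ FL); apply: eq_tsum => h1 h2.
by rewrite (is_linearZ FL).
Qed.

Variables (M : lmodType k) (c : bicomod_ops H M).
Hypothesis cM : is_bicomodule c.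

Lemma lcoact_counit_tsum x (G : H -> M -> U) F :
  (forall h x0, G h x0 = counit h *: F x0) -> is_linear F ->
  tsum (lcoact c x) G = F x.
Proof.
move=> GF FL; rewrite (eq_tsum _ GF) -[in RHS](lcoact_counit cM x).
rewrite (tsumM _ _ FL); apply: eq_tsum => h x0.
by rewrite (is_linearZ FL).
Qed.

Lemma rcoact_counit_tsum x (G : M -> H -> U) F :
  (forall x0 h, G x0 h = counit h *: F x0) -> is_linear F ->
  tsum (rcoact c x) G = F x.
Proof.
move=> GF FL; rewrite (eq_tsum _ GF) -[in RHS](rcoact_counit cM x).
rewrite (tsumM _ _ FL); apply: eq_tsum => x0 h.
by rewrite (is_linearZ FL).
Qed.

Lemma scale_counitM (g h : H) (u : U) :
  counit (g * h) *: u = counit g *: (counit h *: u).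
Proof. by rewrite counitM scalerA. Qed.

Lemma scale_counit1 (u : U) : counit (1 : H) *: u = u.
Proof. by rewrite counit1 scale1r. Qed.

Lemma eq_scale_counit (g h : H) (u v w : U) :
  g = h -> u = v -> counit h *: v = w -> counit g *: u = w.
Proof. by move=> -> ->. Qed.

End Counit.

Lemma scale_tsum (V W U : lmodType k) a (t : (V ⊗ W)%type) (F : V -> W -> U) :
  a *: tsum t F = \tsum_(v, w <- t) a *: F v w.
Proof. exact: scaler_sumr. Qed.

Lemma scale_pull (V W U : lmodType k) a (s : (V ⊗ W)%type) (F G : V -> W -> U) :
  (forall v w, G v w = a *: F v w) -> tsum s G = a *: tsum s F.
Proof. by move=> GF; rewrite scale_tsum; apply: eq_tsum. Qed.

Lemma scale_pull_scale (U : lmodType k) (a b : k) (u v : U) :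
  u = a *: v -> b *: u = a *: (b *: v).
Proof. by move=> ->; rewrite !scalerA mulrC. Qed.

Lemma tsum_pull_scale (V W U : lmodType k) a (t : (V ⊗ W)%type) (F : V -> W -> U) u :
  u = tsum t F -> a *: u = \tsum_(v, w <- t) a *: F v w.
Proof. by move=> ->; apply: scale_tsum. Qed.

Lemma scale_match (U : lmodType k) (a : k) (u v w : U) :
  w = a *: v -> u = v -> a *: u = w.
Proof. by move=> -> ->. Qed.

Lemma tsum_match (V W U : lmodType k) (t : (V ⊗ W)%type) (F G : V -> W -> U) u :
  u = tsum t G -> (forall v w, F v w = G v w) -> tsum t F = u.
Proof. by move=> -> /eq_tsum. Qed.

Lemma eq_norm (X : Type) (x x' x'' y y' y'' : X) :
  x = x' -> x' = x'' -> y = y' -> y' = y'' -> x'' = y'' -> x = y.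
Proof. by move=> -> -> -> -> ->. Qed.

End Multilinear.

(** * Normal forms of Sweedler expressions *)

Ltac tlin :=
  lazymatch goal with |- is_trilinear _ => split=> ? ?; cbv beta; lin end.

Tactic Notation "step" uconstr(e) := refine (etrans e _).

(** Of the four conditions of LR(H) only the two untwisted ones are rules here; the twisted ones
    relate whole sums over a coproduct and enter by hand through the swap lemmas. *)
Ltac nf_rule :=
  lazymatch goal with
  | |- lact ?b _ (amul ?m _ _) = _ =>
      match goal with hb : is_bimodule_algebra m b |- _ => step (lact_amul hb _ _ _) end
  | |- ract ?b (amul ?m _ _) _ = _ =>
      match goal with hb : is_bimodule_algebra m b |- _ => step (ract_amul hb _ _ _) end
  | |- lact ?b _ (lact ?b _ _) = _ =>
      match goal with hb : is_bimodule b |- _ => step (esym (lactM hb _ _ _)) end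
  | |- ract ?b (ract ?b _ _) _ = _ =>
      match goal with hb : is_bimodule b |- _ => step (esym (ractM hb _ _ _)) end
  | |- ract ?b (lact ?b _ _) _ = _ =>
      match goal with hb : is_bimodule b |- _ => step (lract hb _ _ _) end
  | |- lact ?b _ (aone ?m) = _ =>
      match goal with hb : is_bimodule_algebra m b |- _ => step (lact_aone hb _) end
  | |- ract ?b (aone ?m) _ = _ =>
      match goal with hb : is_bimodule_algebra m b |- _ => step (ract_aone hb _) end
  | |- lact ?b 1 _ = _ =>
      match goal with hb : is_bimodule b |- _ => step (lact1 hb _) end
  | |- ract ?b _ 1 = _ =>
      match goal with hb : is_bimodule b |- _ => step (ract1 hb _) end
  | |- lcoact ?c (amul ?m _ _) = _ =>
      match goal with hc : is_bicomodule_algebra m c |- _ => step (lcoact_amul hc _ _) end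
  | |- rcoact ?c (amul ?m _ _) = _ =>
      match goal with hc : is_bicomodule_algebra m c |- _ => step (rcoact_amul hc _ _) end
  | |- lcoact ?c (aone ?m) = _ =>
      match goal with hc : is_bicomodule_algebra m c |- _ => step (lcoact_aone hc) end
  | |- rcoact ?c (aone ?m) = _ =>
      match goal with hc : is_bicomodule_algebra m c |- _ => step (rcoact_aone hc) end
  | |- rcoact ?c (lact ?b _ _) = _ =>
      match goal with hc : is_LR_object b c |- _ => step (LR_lact_rcoact hc _ _) end
  | |- lcoact ?c (ract ?b _ _) = _ =>
      match goal with hc : is_LR_object b c |- _ => step (LR_ract_lcoact hc _ _) end
  | |- amul ?m (aone ?m) _ = _ =>
      match goal with hm : is_algebra m |- _ => step (amul1l hm _) end
  | |- amul ?m _ (aone ?m) = _ =>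
      match goal with hm : is_algebra m |- _ => step (amul1r hm _) end
  | |- amul ?m (amul ?m _ _) _ = _ =>
      match goal with hm : is_algebra m |- _ => step (esym (amulA hm _ _ _)) end
  | |- _ * _ * _ = _ => step (esym (mulrA _ _ _))
  | |- 1 * _ = _ => step (mul1r _)
  | |- _ * 1 = _ => step (mulr1 _)
  | |- GRing.Linear.sort _ (_ * _) = _ => step (comulM _ _)
  | |- GRing.Linear.sort _ 1 = _ => step comul1
  end.

Ltac inside := refine (eq_tsum _ _); intros ? ?; cbv beta.

Ltac inside_scale := refine (f_equal (GRing.scale _) _); cbv beta.

(** The argument is already normal: its leading sums and scalars move past the operation, then
    [nf_rule] acts on what remains. *)
Ltac nf_op1 nf :=
  lazymatch goal with
  | |- ?op (?a *: ?x) = _ =>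
      step (@is_linearZ _ _ _ op _ a x); [lin1 | inside_scale; nf_op1 nf]
  | |- ?op (tsum ?s ?G) = _ => step (@tsumM _ _ _ _ _ s G op _); [lin1 | inside; nf_op1 nf]
  | |- _ => first [nf_rule; nf | reflexivity]
  end.

Ltac nf_op2 nf :=
  lazymatch goal with
  | |- ?op (?a *: ?x) ?y = _ =>
      step (@bilinearZl _ _ _ _ op _ a x y); [bil | inside_scale; nf_op2 nf]
  | |- ?op ?x (?a *: ?y) = _ =>
      step (@bilinearZr _ _ _ _ op _ a x y); [bil | inside_scale; nf_op2 nf]
  | |- ?op (tsum ?s ?G) ?y = _ =>
      step (@tsumMl _ _ _ _ _ _ s G op y _); [bil | inside; nf_op2 nf]
  | |- ?op ?x (tsum ?s ?G) = _ =>
      step (@tsumMr _ _ _ _ _ _ s G op x _); [bil | inside; nf_op2 nf]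
  | |- _ => first [nf_rule; nf | reflexivity]
  end.

Ltac nf_scale nf :=
  lazymatch goal with
  | |- _ *: tsum _ _ = _ => step (scale_tsum _ _ _); inside; nf_scale nf
  | |- GRing.scale (GRing.Linear.sort _ 1) _ = _ => step (scale_counit1 _); reflexivity
  | |- GRing.scale (GRing.Linear.sort _ (_ * _)) _ = _ =>
      step (scale_counitM _ _ _); refine (eq_scale_counit _ _ _);
      [reflexivity | nf_scale nf | nf_scale nf]
  | |- _ => reflexivity
  end.

Ltac nf_tsum nf :=
  lazymatch goal with
  | |- tsum (?a *: ?s) ?F = _ =>
      step (@is_linearZ _ _ _ (fun r => tsum r F) _ a s);
      [refine (tsum_bilinear_linear _); lin | inside_scale; nf_tsum nf]
  | |- tsum (tsum ?s ?G) ?F = _ => step (tsum_tsum s G _); [lin | inside; nf_tsum nf]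
  | |- tsum (tpure _ _) ?F = _ => step (tsum_pure _ _ _); [lin | nf]
  | |- _ => inside; nf
  end.

(* [nf] solves [e = ?e'] by moving all summations of [e] to the front, over
   variables and coactions or coproducts of variables, and the operations, applied
   as far as the bimodule and bicomodule algebra axioms in the context allow, to
   the summand. *)
Ltac nf :=
  cbv beta;
  lazymatch goal with
  | |- tsum _ _ = _ => refine (eq_tsum_arg _ _); [nf | nf_tsum ltac:(nf)]
  | |- lcoact _ _ = _ => refine (eq_op1 _ _); [nf | nf_op1 ltac:(nf)]
  | |- rcoact _ _ = _ => refine (eq_op1 _ _); [nf | nf_op1 ltac:(nf)]
  | |- GRing.Linear.sort _ _ = _ => refine (eq_op1 _ _); [nf | nf_op1 ltac:(nf)]
  | |- amul _ _ _ = _ => refine (eq_op2 _ _ _); [nf | nf | nf_op2 ltac:(nf)]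
  | |- lact _ _ _ = _ => refine (eq_op2 _ _ _); [nf | nf | nf_op2 ltac:(nf)]
  | |- ract _ _ _ = _ => refine (eq_op2 _ _ _); [nf | nf | nf_op2 ltac:(nf)]
  | |- tpure _ _ = _ => refine (eq_op2 _ _ _); [nf | nf | nf_op2 ltac:(nf)]
  | |- _ *: _ = _ => refine (eq_scale_counit _ _ _); [nf | nf | nf_scale ltac:(nf)]
  | |- _ * _ = _ => refine (eq_op2 _ _ _); [nf | nf | nf_op2 ltac:(nf)]
  | |- _ => reflexivity
  end.

(* Solves [e = tsum t ?F]. *)
Ltac pull :=
  cbv beta;
  lazymatch goal with
  | |- tsum ?s ?G = tsum ?t _ =>
      tryif unify s t then reflexivity
      else (refine (tsum_pull _ _); intros ? ?; pull)
  | |- _ *: _ = _ => refine (tsum_pull_scale _ _); pull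
  end.

(** The scalar analogue of [pull]: a given counit factor is moved in front of all sums and other
    scalars. *)
Ltac pull_scale :=
  cbv beta;
  lazymatch goal with
  | |- tsum _ _ = _ => refine (scale_pull _ _); intros ? ?; pull_scale
  | |- ?b *: _ = ?a *: _ =>
      tryif unify a b then reflexivity
      else (refine (scale_pull_scale _ _); pull_scale)
  end.

(** Success of [pull] selects the rule: coassociativity applies if the summand contains the
    coproduct or coaction to be moved; otherwise a counit of a summed component is sought. *)
Ltac ca_rule :=
  lazymatch goal with
  | |- tsum (lcoact ?c _) _ = _ =>
      match goal with hc : is_bicomodule c |- _ =>
        first [ step (lcoactA_tsum hc _ _ _); [intros ? ?; pull | tlin |]
              | step (lcoact_counit_tsum hc _ _ _); [intros ? ?; pull_scale | lin |] ] end
  | |- tsum (rcoact ?c _) _ = _ =>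
      match goal with hc : is_bicomodule c |- _ =>
        first [ step (rcoactA_tsum hc _ _ _); [intros ? ?; pull | tlin |]
              | step (lrcoact_tsum hc _ _ _); [intros ? ?; pull | tlin |]
              | step (rcoact_counit_tsum hc _ _ _); [intros ? ?; pull_scale | lin |] ] end
  | |- tsum (GRing.Linear.sort _ _) _ = _ =>
        first [ step (comulA_tsum _ _ _); [intros ? ?; pull | tlin |]
              | step (counitl_tsum _ _ _); [intros ? ?; pull_scale | lin |]
              | step (counitr_tsum _ _ _); [intros ? ?; pull_scale | lin |] ]
  end.

(* [ca] rewrites iterated coactions towards the shapes
   [comul h = h_1 ⊗ comul h_2], left coactions nested in the comodule factor,
   and left coactions before right ones, and absorbs counits. *)
Ltac ca :=
  cbv beta;
  lazymatch goal with
  | |- tsum ?t ?F = _ =>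
     step (eq_tsum t _); [intros ? ?; ca | first [ca_rule; ca | reflexivity]]
  | |- _ *: _ = _ => inside_scale; ca
  | |- _ => reflexivity
  end.

(* By multilinearity each variable occurs once, so two equal sums in normal form
   are sums over the same tensors up to order, and [ac] only has to match them. *)
Ltac ac :=
  cbv beta;
  lazymatch goal with
  | |- tsum ?t ?F = _ => refine (tsum_match _ _); [pull | intros ? ?; ac]
  | |- _ *: _ = _ => refine (scale_match _ _); [pull_scale | ac]
  | |- _ => try reflexivity
  end.

Ltac sweedler := refine (eq_norm _ _ _ _ _); [nf | ca | nf | ca | ac].

Ltac unf :=
  cbn [amul aone lact ract lcoact rcoact smash smash_bimod_ops smash_bicomod_ops
       regular_bicomod_ops ring_alg_ops tens_alg_ops].

(** * Smash products as algebras *)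

Section Smash.
Variables (k : fieldType) (H : bialgType k) (A B : lmodType k).
Variables (mA : alg_ops A) (cA : bicomod_ops H A) (mB : alg_ops B) (bB : bimod_ops H B).
Hypotheses (hB : is_bimodule_algebra mB bB) (hA : is_bicomodule_algebra mA cA).

Lemma smash_algebra : is_algebra (smash mB bB mA cA).
Proof.
(* The tactics find the axioms by searching the context, so every layer of structure is put
   there. *)
have aB := bimodule_algebra_algebra hB; have aA := bicomodule_algebra_algebra hA.
have bmB := bimodule_algebra_bimodule hB; have cmA := bicomodule_algebra_bicomodule hA.
split.
- change (is_bilinear (amul (smash mB bB mA cA))); unf. lin.
- move=> x y z. unf. sweedler.
(* The bare [x] is written as the sum of its pure tensors, so that both sides are sums over [x]. *)
- move=> x; rewrite -[RHS]tsum_id; unf. sweedler. 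
- move=> x; rewrite -[RHS]tsum_id; unf. sweedler. 
Qed.
End Smash.

Lemma regular_bicomodule_algebra (k : fieldType) (H : bialgType k) :
  is_bicomodule_algebra (ring_alg_ops H) (regular_bicomod_ops H).
Proof.
have aH : is_algebra (ring_alg_ops H).
  split; [exact: bilinear_mul | exact: mulrA | exact: mul1r | exact: mulr1].
split=> //.
(* The three axioms left to [sweedler] are all coassociativity of [comul]. *)
- split=> [|||h||h|h]; unf; [exact: linear_comul | exact: linear_comul
    | exact: comul_counitl | | exact: comul_counitr | | ]; sweedler.
- by split; unf; [exact: linear_comul | exact: comul1 | exact: comulM].
- by split; unf; [exact: linear_comul | exact: comul1 | exact: comulM].
Qed.

(** * Algebras in LR(H) and the structures on their smash products *)

Section LRAlgebra.
Variables (k : fieldType) (H : bialgType k) (A : lmodType k).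
Variables (mA : alg_ops A) (bA : bimod_ops H A) (cA : bicomod_ops H A).
Hypothesis hA : is_LR_algebra mA bA cA.

(** Bilinearity over [H] of the multiplication and unit maps, evaluated at [x ⊗ y] and at 1, gives
    the bimodule algebra axioms. *)
Lemma LR_bimodule_algebra : is_bimodule_algebra mA bA.
Proof.
have aA := LR_algebra_algebra hA; have bmA := LR_bimodule (LR_algebra_object hA).
split=> //.
- move=> h x y; have := LR_morphism_lact (LR_algebra_mul hA) h (x ⊗ y).
  cbn [lact LR_tens_bimod_ops] => E.
  by refine (etrans _ (etrans (esym E) _)); sweedler.
- move=> h; have := LR_morphism_lact (LR_algebra_one hA) h 1.
  (* Scaling in [k^o] is multiplication in [k], so [scalerA] applies. *)
  by cbn [lact LR_unit_bimod_ops]; rewrite scale1r => <-; rewrite -scalerA scale1r.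
- move=> x y h; have := LR_morphism_ract (LR_algebra_mul hA) (x ⊗ y) h.
  cbn [ract LR_tens_bimod_ops] => E.
  by refine (etrans _ (etrans (esym E) _)); sweedler.
- move=> h; have := LR_morphism_ract (LR_algebra_one hA) 1 h.
  by cbn [ract LR_unit_bimod_ops]; rewrite scale1r => <-; rewrite -scalerA scale1r.
Qed.

(** Bicolinearity of the multiplication and unit maps, evaluated likewise, says that the coactions
    are algebra maps. *)
Lemma LR_bicomodule_algebra : is_bicomodule_algebra mA cA.
Proof.
have aA := LR_algebra_algebra hA; have cmA := LR_bicomodule (LR_algebra_object hA).
(* Serves to evaluate the colinearity of the unit at 1, where the scalar ranges over [k^o] and is
   not a counit. *)
have scaleB (x : A) : is_linear (fun a : k^o => (a : k) *: x).
  by move=> a b c; rewrite scalerDl scalerA.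
split=> //.
- split; first exact: lcoact_linear.
    have := LR_morphism_lcoact (LR_algebra_one hA) 1.
    cbn [lcoact LR_unit_bicomod_ops]; rewrite scale1r => ->.
    rewrite tsum_pure ?scale1r //; split=> x.
      exact: (bilinear_compl _ (@bilinear_tpure _ _ _) (@is_linear_id _ _)).
    exact: (bilinear_compr _ (@bilinear_tpure _ _ _) (scaleB _)).
  move=> x y; have := LR_morphism_lcoact (LR_algebra_mul hA) (x ⊗ y).
  cbn [lcoact LR_tens_bicomod_ops]; unf => E.
  by refine (etrans _ (etrans E _)); sweedler.
- split; first exact: rcoact_linear.
    have := LR_morphism_rcoact (LR_algebra_one hA) 1.
    cbn [rcoact LR_unit_bicomod_ops]; rewrite scale1r => ->.
    rewrite tsum_pure ?scale1r //; split=> x.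
      exact: (bilinear_compl _ (@bilinear_tpure _ _ _) (scaleB _)).
    exact: (bilinear_compr _ (@bilinear_tpure _ _ _) (@is_linear_id _ _)).
  move=> x y; have := LR_morphism_rcoact (LR_algebra_mul hA) (x ⊗ y).
  cbn [rcoact LR_tens_bicomod_ops]; unf => E.
  by refine (etrans _ (etrans E _)); sweedler.
Qed.

(* The context [Phi] makes the compatibility axioms of LR(H) applicable under the
   summations that bind [h] and [x]. *)
Lemma LR_lact_lcoact_swap (U : Type) (Phi : (H -> A -> (H ⊗ A)%type) -> U) :
  Phi (fun h x => \tsum_(h1, h2 <- comul h) \tsum_(g, x0 <- lcoact cA (lact bA h1 x))
         (g * h2) ⊗ x0) =
  Phi (fun h x => \tsum_(h1, h2 <- comul h) \tsum_(g, x0 <- lcoact cA x)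
         (h1 * g) ⊗ (lact bA h2 x0)).
Proof.
congr Phi; apply: funext => h; apply: funext => x.
exact: (LR_lact_lcoact (LR_algebra_object hA)).
Qed.

Lemma LR_ract_rcoact_swap (U : Type) (Phi : (H -> A -> (A ⊗ H)%type) -> U) :
  Phi (fun h x => \tsum_(h1, h2 <- comul h) \tsum_(x0, g <- rcoact cA (ract bA x h2))
      x0 ⊗ (h1 * g)) =
  Phi (fun h x => \tsum_(h1, h2 <- comul h) \tsum_(x0, g <- rcoact cA x)
      (ract bA x0 h1) ⊗ (g * h2)).
Proof.
congr Phi; apply: funext => h; apply: funext => x.
exact: (LR_ract_rcoact (LR_algebra_object hA)).
Qed.

Variables (B : lmodType k) (mB : alg_ops B) (bB : bimod_ops H B).
Hypothesis hB : is_bimodule_algebra mB bB.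

Local Notation mH := (ring_alg_ops H).
Local Notation cH := (regular_bicomod_ops H).
Local Notation BA := (smash mB bB mA cA).
Local Notation bBA := (smash_bimod_ops bB bA).
Local Notation AH := (smash mA bA mH cH).
Local Notation cAH := (smash_bicomod_ops cA).
Local Notation BA_H := (smash BA bBA mH cH).
Local Notation B_AH := (smash mB bB AH cAH).

(** The coproduct and its flip are both algebra maps to [H ⊗ H], so the twisted right action is
    again an action. *)
Lemma smash_bimodule : is_bimodule bBA.
Proof.
have hbA := LR_bimodule_algebra.
have bmA := bimodule_algebra_bimodule hbA; have bmB := bimodule_algebra_bimodule hB.
split.
- change (is_bilinear (lact bBA)); unf; lin.
- change (is_bilinear (ract bBA)); unf; lin.
- move=> x; rewrite -[RHS]tsum_id; unf; sweedler.
- move=> h g x; unf; sweedler.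
- move=> x; rewrite -[RHS]tsum_id; unf; sweedler.
- move=> x h g; unf; sweedler.
- move=> h x g; unf; sweedler.
Qed.

Lemma smash_bimodule_algebra : is_bimodule_algebra BA bBA.
Proof.
have hbA := LR_bimodule_algebra; have hcA := LR_bicomodule_algebra.
have hLR := LR_algebra_object hA.
have bmA := bimodule_algebra_bimodule hbA; have bmB := bimodule_algebra_bimodule hB.
have cmA := bicomodule_algebra_bicomodule hcA.
have aA := LR_algebra_algebra hA; have aB := bimodule_algebra_algebra hB.
split; [exact: smash_algebra | exact: smash_bimodule | | | | ].
- move=> h x y; unf.
  (* [T] receives the middle components h_2, h_3: acting on the product gives h_2 a^(-1) ⊗ h_3 .
     a^(0), multiplying the acted factors gives (h_2 . a)^(-1) h_3 ⊗ (h_2 . a)^(0). *)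
  refine (etrans _ (etrans (esym (LR_lact_lcoact_swap (fun T =>
    \tsum_(p, a <- x) \tsum_(p', a' <- y)
      \tsum_(h1, h' <- comul h) \tsum_(h'', h4 <- comul h')
      \tsum_(a'0, r <- rcoact cA a') \tsum_(g, a0 <- T h'' a)
        amul mB (ract bB (lact bB h1 p) r) (lact bB g p')
        ⊗ amul mA a0 (lact bA h4 a'0)))) _)); sweedler.
- move=> h; unf; sweedler.
- move=> x y h; unf.
  (* Again h_2, h_3: a'^<0> . h_2 ⊗ a'^<1> h_3 becomes (a' . h_3)^<0> ⊗ h_2 (a' . h_3)^<1>. *)
  refine (etrans _ (etrans (esym (LR_ract_rcoact_swap (fun T =>
    \tsum_(p, a <- x) \tsum_(p', a' <- y)
      \tsum_(h1, h' <- comul h) \tsum_(h'', h4 <- comul h')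
      \tsum_(g, a0 <- lcoact cA a) \tsum_(a'0, r <- T h'' a')
        amul mB (ract bB p r) (ract bB (lact bB g p') h4)
        ⊗ amul mA (ract bA a0 h1) a'0))) _)); sweedler.
- move=> h; unf; sweedler.
Qed.

(** Dually to the actions, the product of [H] and its opposite are coalgebra maps, so both coactions
    are coassociative. *)
Lemma smash_bicomodule : is_bicomodule cAH.
Proof.
have cmA := LR_bicomodule (LR_algebra_object hA).
split.
- change (is_linear (lcoact cAH)); unf; lin.
- change (is_linear (rcoact cAH)); unf; lin.
- move=> x; rewrite -[RHS]tsum_id; unf; sweedler.
- move=> x; unf; sweedler.
- move=> x; rewrite -[RHS]tsum_id; unf; sweedler.
- move=> x; unf; sweedler.
- move=> x; unf; sweedler.
Qed.

Lemma smash_bicomodule_algebra : is_bicomodule_algebra AH cAH.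
Proof.
have hbA := LR_bimodule_algebra; have hcA := LR_bicomodule_algebra.
have hLR := LR_algebra_object hA.
have bmA := bimodule_algebra_bimodule hbA.
have cmA := bicomodule_algebra_bicomodule hcA.
have aA := LR_algebra_algebra hA.
split; [exact: smash_algebra (regular_bicomodule_algebra H) | exact: smash_bicomodule | | ].
- split; [exact: (lcoact_linear smash_bicomodule) | by unf; sweedler | ].
  move=> x y; unf.
  (* The exchange concerns the first two components of [h]: coacting on the product produces (h_1 .
     a')^(-1) h_2. *)
  refine (etrans _ (etrans (LR_lact_lcoact_swap (fun T =>
    \tsum_(a, h <- x) \tsum_(a', h' <- y)
      \tsum_(h1, h2 <- comul h) \tsum_(h'1, h'2 <- comul h')
      \tsum_(h'3, h'4 <- comul h'2)
      \tsum_(r, a0 <- lcoact cA a) \tsum_(g, a'0 <- T h1 a')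
        (r * (g * h'1)) ⊗ (amul mA (ract bA a0 h'4) a'0 ⊗ (h2 * h'3)))) _)); sweedler.
- split; [exact: (rcoact_linear smash_bicomodule) | by unf; sweedler | ].
  move=> x y; unf.
  (* Here it concerns the last two components of [h']: coacting on the product produces h'_2 (a .
     h'_3)^<1>. *)
  refine (etrans _ (etrans (LR_ract_rcoact_swap (fun T =>
    \tsum_(a, h <- x) \tsum_(a', h' <- y)
      \tsum_(h1, h2 <- comul h) \tsum_(h'1, h'2 <- comul h')
      \tsum_(h3, h4 <- comul h2)
      \tsum_(a'0, r <- rcoact cA a') \tsum_(a0, g <- T h'2 a)
        (amul mA a0 (lact bA h1 a'0) ⊗ (h3 * h'1)) ⊗ (h4 * (g * r)))) _)); sweedler.
Qed.

(** Both products of p ⊗ a ⊗ h and p' ⊗ a' ⊗ h' become (p . h'_3 a'^<1>)(a^(-1) h_1 . p') ⊗ (a^(0) .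
    h'_2)(h_2 . a'^<0>) ⊗ h_3 h'_1, the first by the untwisted conditions of LR(H). *)
Lemma tassoc_algebra_map : is_algebra_map BA_H B_AH (@tassoc k B A H).
Proof.
have hbA := LR_bimodule_algebra; have hcA := LR_bicomodule_algebra.
have hLR := LR_algebra_object hA.
have bmA := bimodule_algebra_bimodule hbA; have bmB := bimodule_algebra_bimodule hB.
have cmA := bicomodule_algebra_bicomodule hcA.
have aA := LR_algebra_algebra hA; have aB := bimodule_algebra_algebra hB.
split.
- change (is_linear (@tassoc k B A H)); rewrite /tassoc; lin.
- rewrite /tassoc; unf; sweedler.
- move=> x y; rewrite /tassoc; unf; sweedler.
Qed.

End LRAlgebra.

(** * Reassociation of triple tensor products and the final assembly *)

Lemma tassoc_bijective (k : fieldType) (V W U : lmodType k) :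
  bijective (@tassoc k V W U).
Proof.
exists (fun t => \tsum_(v, s <- t) \tsum_(w, u <- s) (v ⊗ w) ⊗ u) => t.
(* The round trip decomposes [t] and then its factor [s]; [tsum_id] reassembles both levels. *)
- transitivity (\tsum_(s, u <- t) (\tsum_(v, w <- s) v ⊗ w) ⊗ u).
    by rewrite /tassoc; sweedler.
  by rewrite -[RHS]tsum_id; apply: eq_tsum => s u; rewrite tsum_id.
- transitivity (\tsum_(v, s <- t) v ⊗ (\tsum_(w, u <- s) w ⊗ u)).
    by rewrite /tassoc; sweedler.
  by rewrite -[RHS]tsum_id; apply: eq_tsum => v s; rewrite tsum_id.
Qed.

(** The two triple tensor products are distinct types, so coincidence of the algebras is expressed
    as [tassoc] being a bijective algebra map. *)
Theorem proposition3p2 (k : fieldType) (H : bialgType k)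
    (A : lmodType k) (mA : alg_ops A) (bA : bimod_ops H A)
    (cA : bicomod_ops H A) (hA : is_LR_algebra mA bA cA)
    (B : lmodType k) (mB : alg_ops B) (bB : bimod_ops H B)
    (hB : is_bimodule_algebra mB bB) :
  let mH := ring_alg_ops H in
  let cH := regular_bicomod_ops H in
  let BA := smash mB bB mA cA in
  let bBA := smash_bimod_ops bB bA in
  let AH := smash mA bA mH cH in
  let cAH := smash_bicomod_ops cA in
  let BA_H := smash BA bBA mH cH in
  let B_AH := smash mB bB AH cAH in
  [/\ is_bimodule_algebra BA bBA,
      is_bicomodule_algebra AH cAH
    & [/\ is_algebra BA_H, is_algebra B_AH,
          bijective (@tassoc k B A H)
        & is_algebra_map BA_H B_AH (@tassoc k B A H)]].
Proof.
move=> mH cH BA bBA AH cAH BA_H B_AH.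
have hBA : is_bimodule_algebra BA bBA by apply: smash_bimodule_algebra.
have hAH : is_bicomodule_algebra AH cAH by apply: smash_bicomodule_algebra.
split=> //; split; last exact: tassoc_algebra_map.
(* The outer smash products are algebras because (i) and (ii) equip the inner ones with the required
   structures. *)
- exact: smash_algebra hBA (regular_bicomodule_algebra H).
- exact: smash_algebra.
- exact: tassoc_bijective.
Qed.
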